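(* The functor $G\colon\mathbf{HausCMon}\to\mathbf{\Sigma}_{\mathrm{ft}}$, which equips each Hausdorff commutative monoid with its extended monoid operation and acts as the identity on (underlying functions of) morphisms, has a left adjoint.
   Context: Families. Fix an infinite set $\mathcal I$. A family of elements of a set $X$ is an indexed multiset $\{x_i\}_{i\in I}$ with $x_i\in X$ and $I\subseteq\mathcal I$ countable (finite and empty allowed); two families $\{x_i\}_I,\{y_j\}_J$ are identified if there is a bijection $\phi\colon I\to J$ with $x_i=y_{\phi(i)}$ for all $i$. $X^*$ is the set of all families; bold letters denote families. The disjoint union $\uplus_J\mathbf x_j$ of families is indexed by the disjoint union of the index sets. A subfamily is the restriction of a family to a subset of its index set. For $f\colon X\to Y$ and $\mathbf x=\{x_i\}_I$, $f\mathbf x=\{f(x_i)\}_I$. For a partial function $\Sigma\colon X^*\rightharpoonup X$, ''$\Sigma\mathbf x\simeq x$'' means $\Sigma\mathbf x$ is defined and equals $x$; $\mathbf x$ is summable if $\Sigma\mathbf x$ is defined. A weak $\Sigma$-monoid is a set $X$ with a partial function $\Sigma\colon X^*\rightharpoonup X$ such that: (Singleton) $\Sigma\{x\}\simeq x$ for all $x\in X$; (Neutral element) there is $0\in X$ with $\Sigma\emptyset\simeq 0$, and if $\mathbf x$ is summable then so is its subfamily $\mathbf x_\emptyset$ of elements other than $0$; (Bracketing) if $\{\mathbf x_j\}_J$ ($J$ countable) is an indexed set of finite summable families and $\mathbf x=\uplus_J\mathbf x_j$, then $\Sigma\mathbf x\simeq x$ implies $\Sigma\{\Sigma\mathbf x_j\}_J\simeq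 x$; (Flattening) if $\{\mathbf x_j\}_J$ is a finite indexed set of (possibly infinite) summable families and $\mathbf x=\uplus_J\mathbf x_j$, then $\Sigma\{\Sigma\mathbf x_j\}_J\simeq x$ implies $\Sigma\mathbf x\simeq x$. A finitely total $\Sigma$-monoid is a weak $\Sigma$-monoid in which every finite family is summable. A $\Sigma$-homomorphism $f\colon(X,\Sigma)\to(Y,\Sigma')$ is a function such that $\Sigma\mathbf x\simeq x$ implies $\Sigma' f\mathbf x\simeq f(x)$, for all $\mathbf x\in X^*$, $x\in X$. $\mathbf{\Sigma}_{\mathrm{ft}}$ is the category of finitely total $\Sigma$-monoids and $\Sigma$-homomorphisms. A Hausdorff commutative monoid $(X,\tau,+)$ is a commutative monoid $(X,+)$ with a Hausdorff topology $\tau$ on $X$ for which $+\colon X\times X\to X$ is continuous. $\mathbf{HausCMon}$ is the category of Hausdorff commutative monoids and continuous monoid homomorphisms. The extended monoid operation $\Sigma\colon X^*\rightharpoonup X$ of $(X,\tau,+)$ is: for $\mathbf x\in X^*$ let $\mathcal F(\mathbf x)$ be the directed set of finite subfamilies of $\mathbf x$ ordered by inclusion, and $\sigma\colon\mathcal F(\mathbf x)\to X$ the net sending a finite subfamily to the sum of its elements under $+$; then $\Sigma\mathbf x=x$ if $\lim\sigma=x$, and $\Sigma\mathbf x$ is undefined if $\sigma$ has no limit. With this operation $X$ is a finitely total $\Sigma$-monoid $G(X)$, and continuous monoid homomorphisms are $\Sigma$-homomorphisms, so $G$ is a functor. *)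

(* Defs.v *)
From mathcomp Require Import all_boot all_order all_algebra finmap.
From mathcomp Require Import all_classical topology tvs.
From mathcomp.analysis Require showcase.summability.

Set Implicit Arguments.
Unset Strict Implicit.
Unset Printing Implicit Defensive.

Import GRing.Theory.
Local Open Scope classical_set_scope.

Record category := Category {
  ob :> Type;
  hom : ob -> ob -> Type;
  idm : forall a, hom a a;
  compm : forall a b c, hom b c -> hom a b -> hom a c;
  compm_idl : forall a b (f : hom a b), compm (idm b) f = f;
  compm_idr : forall a b (f : hom a b), compm f (idm a) = f;
  compm_assoc : forall a b c d (h : hom c d) (g : hom b c) (f : hom a b),
    compm h (compm g f) = compm (compm h g) f }.

Arguments idm {_} a.
Arguments compm {_} [a b c] _ _.

Record functor (C D : category) := Functor {
  fobj :> C -> D;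
  fmap : forall a b : C, hom a b -> hom (fobj a) (fobj b);
  fmap_id : forall a : C, fmap (idm a) = idm (fobj a);
  fmap_comp : forall (a b c : C) (g : hom b c) (f : hom a b),
    fmap (compm g f) = compm (fmap g) (fmap f) }.

Arguments fmap {C D} _ [a b] _.

Definition is_left_adjoint (C D : category) (F : functor D C) (G : functor C D)
    : Prop :=
  exists phi : forall (d : D) (c : C), hom (F d) c -> hom d (G c),
    [/\ forall d c, bijective (@phi d c),
        forall d c c' (f : hom (F d) c) (g : hom c c'),
          phi d c' (compm g f) = compm (fmap G g) (phi d c f)
      & forall d d' c (f : hom (F d) c) (h : hom d' d),
          phi d' c (compm f (fmap F h)) = compm (phi d c f) h ].

Definition has_left_adjoint (C D : category) (G : functor C D) : Prop :=
  exists F : functor D C, is_left_adjoint F G.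

(* Families are taken here before identification up to bijections of the index
   sets; a function on X^* is a function on [family I X] that is invariant
   under [fam_equiv]. *)
Record family (I : choiceType) (X : Type) := Family {
  fam_index : set I;
  fam_countable : countable fam_index;
  fam_member :> fam_index -> X }.

Section Families.
Context {I : choiceType}.

Definition fam_equiv X (x y : family I X) : Prop :=
  exists phi : fam_index x -> fam_index y,
    bijective phi /\ forall i, x i = y (phi i).

Definition fam_empty X : family I X :=
  @Family I X set0 (countable0 I)
    (fun i : set0 => match set_mem (valP i) : False with end).

Definition fam_single X (i : I) (v : X) : family I X :=
  @Family I X [set i] (countable1 i) (fun=> v).

Definition fam_map X Y (f : X -> Y) (x : family I X) : family I Y :=
  Family (fam_countable x) (f \o x).

Lemma subfam_countable X (x : family I X) (A : set (fam_index x)) :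
  countable (val @` A).
Proof.
apply: (sub_countable (subset_card_le _) (fam_countable x)).
by move=> _ [j _ <-]; exact: set_mem (valP j).
Qed.

Definition subfam X (x : family I X) (A : set (fam_index x)) : family I X :=
  Family (subfam_countable A)
    (fun k : val @` A => x (s2val (cid2 (set_mem (valP k))))).

(* [x] represents the disjoint union of the families [xs j]. The sigma type
   that indexes this union is not a subset of [I], hence the bijection. *)
Definition is_disjoint_union X (xs : family I (family I X)) (x : family I X)
    : Prop :=
  exists phi : fam_index x -> {j : fam_index xs & fam_index (xs j)},
    bijective phi /\ forall i, x i = xs (tag (phi i)) (tagged (phi i)).

End Families.

(* A partial function X^* -> X, as an option-valued function on
   representatives; [S x = Some v] reads "S x is defined and equals v". *)
Definition summable (I : choiceType) (X : Type) (S : family I X -> option X)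
    (x : family I X) : Prop :=
  exists v, S x = Some v.

Record is_weak_sigma_monoid (I : choiceType) (X : Type)
    (S : family I X -> option X) : Prop := IsWeakSigmaMonoid {
  sigma_equiv : forall x y, fam_equiv x y -> S x = S y;
  sigma_single : forall i v, S (fam_single i v) = Some v;
  sigma_neutral : exists zero : X,
    S (fam_empty X) = Some zero /\
    forall x, summable S x -> summable S (subfam [set i | x i <> zero]);
  sigma_bracketing : forall (xs : family I (family I X)) (s : fam_index xs -> X)
      (x : family I X) (v : X),
    (forall j, finite_set (fam_index (xs j))) ->
    (forall j, S (xs j) = Some (s j)) ->
    is_disjoint_union xs x ->
    S x = Some v -> S (Family (fam_countable xs) s) = Some v;
  sigma_flattening : forall (xs : family I (family I X)) (s : fam_index xs -> X)
      (x : family I X) (v : X),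
    finite_set (fam_index xs) ->
    (forall j, S (xs j) = Some (s j)) ->
    is_disjoint_union xs x ->
    S (Family (fam_countable xs) s) = Some v -> S x = Some v }.

Record ftSigmaMonoid (I : choiceType) := FtSigmaMonoid {
  sm_carrier :> Type;
  sm_sum : family I sm_carrier -> option sm_carrier;
  sm_weak : is_weak_sigma_monoid sm_sum;
  sm_finitely_total : forall x, finite_set (fam_index x) -> summable sm_sum x }.

Record sigmaHom (I : choiceType) (X Y : ftSigmaMonoid I) := SigmaHom {
  sigmaHom_fun :> X -> Y;
  sigmaHomP : forall (x : family I X) (v : X),
    sm_sum x = Some v -> sm_sum (fam_map sigmaHom_fun x) = Some (sigmaHom_fun v) }.

Section SigmaFt.
Context (I : choiceType).
Implicit Types X Y Z : ftSigmaMonoid I.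

Lemma sigmaHom_eq X Y (f g : sigmaHom X Y) : f =1 g -> f = g.
Proof.
case: f g => [f fP] [g gP] /= /funext fg; rewrite {}fg in fP *.
by congr SigmaHom; exact: Prop_irrelevance.
Qed.

Definition sigmaHom_id X : sigmaHom X X.
Proof. by exists id => -[]. Defined.

Definition sigmaHom_comp X Y Z (g : sigmaHom Y Z) (f : sigmaHom X Y) :
  sigmaHom X Z.
Proof.
exists (g \o f) => x v xv.
exact: (@sigmaHomP _ _ _ g _ _ (@sigmaHomP _ _ _ f _ _ xv)).
Defined.

Definition SigmaFt : category.
Proof.
apply: (@Category (ftSigmaMonoid I) (@sigmaHom I) sigmaHom_id sigmaHom_comp).
- by move=> *; exact: sigmaHom_eq.
- by move=> *; exact: sigmaHom_eq.
- by move=> *; exact: sigmaHom_eq.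
Defined.

End SigmaFt.

Record hausCMon := HausCMonOb {
  hcm_carrier :> TopologicalNmodule.type;
  hcm_hausdorff : hausdorff_space hcm_carrier }.

Record hausCMonHom (X Y : hausCMon) := HausCMonHom {
  hausCMonHom_fun :> X -> Y;
  hausCMonHom_morphism : GRing.nmod_morphism hausCMonHom_fun;
  hausCMonHom_continuous : continuous hausCMonHom_fun }.

Lemma hausCMonHom_eq (X Y : hausCMon) (f g : hausCMonHom X Y) :
  f =1 g -> f = g.
Proof.
case: f g => [f fM fC] [g gM gC] /= /funext fg; rewrite {}fg in fM fC *.
by congr HausCMonHom; exact: Prop_irrelevance.
Qed.

Definition hausCMonHom_id (X : hausCMon) : hausCMonHom X X.
Proof. by exists id => // x; exact: cvg_id. Defined.

Definition hausCMonHom_comp (X Y Z : hausCMon)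
  (g : hausCMonHom Y Z) (f : hausCMonHom X Y) : hausCMonHom X Z.
Proof.
exists (g \o f); last first.
  move=> x; apply: continuous_comp; first exact: hausCMonHom_continuous.
  exact: hausCMonHom_continuous.
have [f0 fD] := hausCMonHom_morphism f.
have [g0 gD] := hausCMonHom_morphism g.
by split => [|x y] /=; rewrite ?f0 ?g0 // fD gD.
Defined.

Definition HausCMon : category.
Proof.
apply: (@Category hausCMon hausCMonHom hausCMonHom_id hausCMonHom_comp).
- by move=> *; exact: hausCMonHom_eq.
- by move=> *; exact: hausCMonHom_eq.
- by move=> *; exact: hausCMonHom_eq.
Defined.

(* The net of finite partial sums: [totally] is the filter on {fset fam_index x}
   generated by the sets {B | A `<=` B}, so this is convergence of the net
   indexed by the finite subsets of the index set ordered by inclusion. *)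
Definition is_sum (I : choiceType) (X : TopologicalNmodule.type)
    (x : family I X) (v : X) : Prop :=
  (fun A : {fset fam_index x} => (\sum_(i <- A) x i)%R) @ summability.totally --> v.

Definition extended_sum (I : choiceType) (X : TopologicalNmodule.type)
    (x : family I X) : option X :=
  match pselect (exists v, is_sum x v) with
  | left h => Some (sval (cid h))
  | right _ => None
  end.

Section ExtendedSum.
Local Open Scope ring_scope.

Definition seq_sum (K : choiceType) (X : TopologicalNmodule.type) (f : K -> X)
    (v : X) : Prop :=
  forall U, nbhs v U -> exists A : seq K, forall s : seq K,
    uniq s -> {subset A <= s} -> U (\sum_(i <- s) f i).

Lemma is_sumP (I : choiceType) (X : TopologicalNmodule.type) (x : family I X) v :
  is_sum x v <-> seq_sum x v.
Proof.
split=> [xv U /xv[A _ AU]|xv U /xv[A AU]].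
- exists A => s us As.
  have -> : \sum_(i <- s) x i = \sum_(i <- [fset k in s]%fset) x i.
    apply/perm_big/uniq_perm => // k; by rewrite in_fset.
  by apply: AU; apply/fsubsetP => k /As; rewrite in_fset.
- exists [fset k in A]%fset => // B /= /fsubsetP AB; apply: AU => // k kA.
  by apply: AB; rewrite in_fset.
Qed.

Lemma extended_sumP (I : choiceType) (X : hausCMon) (x : family I X) v :
  extended_sum x = Some v <-> seq_sum x v.
Proof.
rewrite -is_sumP /extended_sum.
case: pselect => [h|h]; last by split=> // xv; case: h; exists v.
case: (cid h) => w wP /=; split=> [[<-] //|xv]; congr Some.
apply: (cvg_unique (@hcm_hausdorff X)) wP xv.
exact/fmap_proper_filter/summability.totally_filter.
Qed.

Section SeqSum.
Context {X : TopologicalNmodule.type}.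

Lemma seq_sum_fin (K : choiceType) (f : K -> X) (E : seq K) :
  uniq E -> (forall k, k \in E) -> seq_sum f (\sum_(k <- E) f k).
Proof.
move=> uE EE U /nbhs_singleton UE; exists E => s us Es.
by rewrite (perm_big E) //; apply: uniq_perm => // k; rewrite EE Es.
Qed.

Lemma seq_sum_bij (K L : choiceType) (phi : K -> L) (f : K -> X) (g : L -> X) v :
  bijective phi -> (forall k, f k = g (phi k)) -> seq_sum g v <-> seq_sum f v.
Proof.
case=> psi phiK psiK fg; split=> [gv U /gv[A AU]|fv U /fv[A AU]].
- exists (map psi A) => s us As; under eq_bigr do rewrite fg.
  rewrite -(big_map phi predT); apply: AU.
    by rewrite map_inj_uniq //; exact: can_inj phiK.
  move=> l lA; rewrite -[l]psiK map_f //; apply: As; exact: map_f.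
- exists (map phi A) => s us As.
  have -> : \sum_(i <- s) g i = \sum_(i <- map psi s) f i.
    by rewrite big_map; under [RHS]eq_bigr do rewrite fg psiK.
  apply: AU; first by rewrite map_inj_uniq //; exact: can_inj psiK.
  move=> k kA; rewrite -[k]phiK map_f //; apply: As; exact: map_f.
Qed.

Lemma seq_sum_support (K L : choiceType) (g : L -> K) (f : K -> X) v :
  injective g -> (forall i, f i != 0 -> exists k, g k = i) ->
  seq_sum f v -> seq_sum (f \o g) v.
Proof.
move=> gI g0 fv U /fv[A AU].
have [B BA] : exists B : seq L, forall i, i \in A -> f i != 0 ->
    exists2 k, k \in B & g k = i.
  elim: A {AU} => [|a A [B BA]]; first by exists [::].
  have [fa|/g0[k gk]] := eqVneq (f a) 0.
    exists B => i; rewrite inE => /predU1P[->|iA]; first by rewrite fa eqxx.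
    exact: BA.
  exists (k :: B) => i; rewrite inE => /predU1P[-> _|iA /(BA _ iA)[l lB <-]].
    by exists k => //; rewrite mem_head.
  by exists l => //; rewrite inE lB orbT.
exists B => s us Bs; rewrite -(big_map g predT f).
pose Z := undup [seq i <- A | i \notin map g s].
have -> : \sum_(i <- map g s) f i = \sum_(i <- map g s ++ Z) f i.
  rewrite big_cat /= [\sum_(i <- Z) _]big1_seq ?addr0 // => i /=.
  rewrite mem_undup mem_filter => /andP[/negP igs iA].
  apply/eqP/negPn/negP => /(BA _ iA)[k kB gk]; apply: igs.
  by rewrite -gk map_f // Bs.
apply: AU.
  rewrite cat_uniq map_inj_uniq // us undup_uniq andbT.
  by apply/hasPn => i; rewrite mem_undup mem_filter => /andP[].
by move=> i iA; rewrite mem_cat mem_undup mem_filter iA andbT orbN.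
Qed.

Lemma seq_sum_bracketing (J : choiceType) (K : J -> choiceType)
    (f : {j : J & K j} -> X) (E : forall j, seq (K j)) (s : J -> X) v :
  (forall j, uniq (E j)) -> (forall j k, k \in E j) ->
  (forall j, s j = \sum_(k <- E j) f (Tagged K k)) ->
  seq_sum f v -> seq_sum s v.
Proof.
move=> uE EE sE fv U /fv[A AU]; exists (map tag A) => t ut At.
under eq_bigr do rewrite sE.
rewrite -(big_allpairs_dep (h := fun j (k : K j) => Tagged K k) (r2 := E)
  (F := f)).
apply: AU.
- by apply: allpairs_uniq_dep => // -[j k] [j' k'] _ _ /= [].
- move=> [j k] pA; apply: allpairs_f_dep => //.
  by apply: At; exact: (map_f tag pA).
Qed.

Lemma nbhs_sum (J : choiceType) (s : J -> X) (E : seq J) U :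
  nbhs (\sum_(j <- E) s j) U -> exists W : J -> set X,
    (forall j, nbhs (s j) (W j)) /\
    forall t : J -> X, (forall j, W j (t j)) -> U (\sum_(j <- E) t j).
Proof.
elim: E U => [|j E IH] U; rewrite ?big_nil ?big_cons.
  move=> /nbhs_singleton U0; exists (fun=> setT); split=> [j|t _].
    exact: filterT.
  by rewrite big_nil.
move=> /(@add_continuous X (s j, \sum_(j <- E) s j)) [[A B]] /= [Aj /IH[W [nW WB]]] AB.
exists (fun i => W i `&` [set y | i = j -> A y]); split=> [i|t tW].
  apply: filterI; first exact: nW.
  case: (pselect (i = j)) => [->|ij]; first by apply: (filterS _ Aj) => y Ay _; exact: Ay.
  by apply: (filterS _ filterT) => y _ /ij [].
rewrite big_cons; apply: (AB (_, _)); split=> /=; first by case: (tW j) => _; exact.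
by apply: WB => i; case: (tW i).
Qed.

Lemma seq_Tagged (J : choiceType) (K : J -> choiceType) (j : J)
    (r : seq {j : J & K j}) :
  exists t : seq (K j), [seq p <- r | tag p == j] = map (Tagged K) t.
Proof.
elim: r => [|[i k] r [t IH]]; first by exists [::].
rewrite /=; case: eqP => [ij|_]; last by exists t.
by rewrite {i}ij in k *; exists (k :: t); rewrite IH.
Qed.

Lemma seq_sum_flattening (J : choiceType) (K : J -> choiceType)
    (f : {j : J & K j} -> X) (E : seq J) (s : J -> X) :
  uniq E -> (forall j, j \in E) ->
  (forall j, seq_sum (fun k : K j => f (Tagged K k)) (s j)) ->
  seq_sum f (\sum_(j <- E) s j).
Proof.
move=> uE EE sE U /nbhs_sum[W [nW WU]].
have /choice[A AW] : forall j, exists A : seq {j : J & K j}, forall r,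
    uniq r -> {subset A <= r} -> W j (\sum_(p <- r | tag p == j) f p).
  move=> j; have [A AW] := sE j _ (nW j).
  exists (map (Tagged K) A) => r ur Ar.
  have [t tE] := seq_Tagged j r; rewrite -big_filter tE big_map; apply: AW.
    by apply/(@map_uniq _ _ (Tagged K)); rewrite -tE filter_uniq.
  move=> k kA; have : Tagged K k \in map (Tagged K) t.
    by rewrite -tE mem_filter eqxx Ar // map_f.
  by case/mapP => k' k't /eqP; rewrite eq_Tagged /= => /eqP ->.
exists (flatten (map A E)) => r ur Ar.
have -> : \sum_(p <- r) f p = \sum_(j <- E) \sum_(p <- r | tag p == j) f p.
  rewrite (exchange_big_dep predT) //=; apply: eq_bigr => p _.
  rewrite (big_rem (tag p)) //= eqxx big_seq_cond big1 ?addr0 // => j.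
  by rewrite mem_rem_uniq // !inE => /andP[/andP[/negP jp _] /eqP pj]; case: jp; rewrite pj.
apply: WU => j; apply: AW => // p pA; apply: Ar.
by apply/flattenP; exists (A j) => //; exact: map_f.
Qed.

End SeqSum.

Lemma finite_index (I : choiceType) X (x : family I X) :
  finite_set (fam_index x) -> exists E : seq (fam_index x), uniq E /\ forall i, i \in E.
Proof.
move=> /finite_seqP[s sE]; exists (undup (pmap insub s)).
split=> [|i]; first exact: undup_uniq.
rewrite mem_undup mem_pmap_sub /=.
have : [set` s] (val i) by rewrite -sE; exact: set_mem (valP i).
by [].
Qed.

Lemma extended_sum_finite (I : choiceType) (X : hausCMon) (x : family I X)
    (E : seq (fam_index x)) : uniq E -> (forall i, i \in E) ->
  extended_sum x = Some (\sum_(i <- E) x i).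
Proof. by move=> uE EE; apply/extended_sumP; exact: seq_sum_fin. Qed.

Lemma extended_sum_weak (I : choiceType) (X : hausCMon) :
  is_weak_sigma_monoid (@extended_sum I X).
Proof.
split.
- move=> x y [phi [bphi xy]].
  have H v : extended_sum x = Some v <-> extended_sum y = Some v.
    by rewrite !extended_sumP; symmetry; exact: (seq_sum_bij v bphi xy).
  case xE: (extended_sum x) => [v|]; first by symmetry; apply/H.
  by case yE: (extended_sum y) => [v|//]; move/H: yE; rewrite xE.
- move=> i v; rewrite (@extended_sum_finite _ _ _ [:: exist _ i (mem_set erefl)]) //.
    by rewrite big_seq1.
  by move=> k; rewrite inE -val_eqE; apply/eqP; exact: set_mem (valP k).
- exists 0; split.
    rewrite (@extended_sum_finite _ _ _ [::]) ?big_nil // => i.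
    by case: (set_mem (valP i)).
  move=> x [v /extended_sumP xv]; exists v; apply/extended_sumP.
  set y := subfam _.
  pose g (k : fam_index y) : fam_index x := s2val (cid2 (set_mem (valP k))).
  have gV k : val (g k) = val k by rewrite /g; case: (cid2 _).
  apply: (@seq_sum_support _ _ _ g _ _ _ _ xv).
    by move=> k l kl; apply/val_inj; rewrite -!gV kl.
  move=> i /eqP xi; have ki : val i \in fam_index y by apply/mem_set; exists i.
  by exists (exist _ (val i) ki); apply/val_inj; rewrite gV.
- move=> xs s x v xsf sE [phi [bphi xE]] /extended_sumP xv.
  apply/extended_sumP.
  pose E j := cid (finite_index (xsf j)).
  apply: (@seq_sum_bracketing _ _ _ (fun p => xs (tag p) (tagged p))
    (fun j => sval (E j))).
  + by move=> j; case: (svalP (E j)).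
  + by move=> j; case: (svalP (E j)).
  + move=> j; apply: Some_inj; rewrite -sE.
    by case: (svalP (E j)) => *; exact: extended_sum_finite.
  + exact/(seq_sum_bij (f := x) _ bphi xE).
- move=> xs s x v /finite_index[E [uE EE]] sE [phi [bphi xE]].
  rewrite (@extended_sum_finite _ _ (Family _ s) E) //= => -[<-].
  pose f (p : {j : fam_index xs & fam_index (xs j)}) := xs (tag p) (tagged p).
  apply/extended_sumP/(seq_sum_bij (f := x) (g := f) _ bphi xE).
  apply: (@seq_sum_flattening X (fam_index xs) (fun j => fam_index (xs j))
    f E s uE EE) => j.
  exact: (extended_sumP _ _).1 (sE j).
Qed.

Lemma extended_sum_finitely_total (I : choiceType) (X : hausCMon)
  (x : family I X) : finite_set (fam_index x) -> summable (@extended_sum I X) x.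
Proof.
case/finite_index => E [uE EE]; exists (\sum_(i <- E) x i).
exact: extended_sum_finite.
Qed.

Lemma extended_sum_morphism (I : choiceType) (X Y : hausCMon)
    (f : hausCMonHom X Y) (x : family I X) (v : X) :
  extended_sum x = Some v -> extended_sum (fam_map f x) = Some (f v).
Proof.
move=> /extended_sumP xv; apply/extended_sumP => U.
move=> /hausCMonHom_continuous/xv[A AU]; exists A => s us As.
have [f0 fD] := hausCMonHom_morphism f.
by have := AU s us As; rewrite /= (big_morph f fD f0).
Qed.

End ExtendedSum.

Definition G_obj (I : choiceType) (X : hausCMon) : ftSigmaMonoid I :=
  FtSigmaMonoid (@extended_sum_weak I X) (@extended_sum_finitely_total I X).

Definition G_hom (I : choiceType) (X Y : hausCMon) (f : hausCMonHom X Y) :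
    sigmaHom (G_obj I X) (G_obj I Y) :=
  @SigmaHom I (G_obj I X) (G_obj I Y) f (@extended_sum_morphism I X Y f).

Definition G (I : choiceType) : functor HausCMon (SigmaFt I).
Proof.
apply: (@Functor HausCMon (SigmaFt I) (@G_obj I) (@G_hom I)).
- by move=> *; exact: sigmaHom_eq.
- by move=> *; exact: sigmaHom_eq.
Defined.

(* Main.v *)
From mathcomp Require Import all_boot all_classical.
From HB Require Import structures.
From mathcomp Require Import ssralg finmap topology tvs.
From mathcomp.analysis Require showcase.summability.
Require Import Defs.

(** For a finitely total Sigma-monoid [X], a Sigma-homomorphism from [X] to some
    [G C] factors through its image, a submonoid of [C] that is a quotient of
    [X].  So the left adjoint sends [X] to its quotient by the
    relation "not separated by any Sigma-homomorphism into a Hausdorff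
    commutative monoid", with the coarsest topology making all these
    homomorphisms continuous.  The induced maps separate points, so the monoid
    laws, the continuity of addition and the Hausdorff property are all
    inherited from the targets.  Quantifying over all targets inside
    propositions replaces the choice of a solution set. *)

Set Implicit Arguments.
Unset Strict Implicit.
Unset Printing Implicit Defensive.

Import GRing.Theory.
Local Open Scope classical_set_scope.

(** A universal arrow [eta d] for every [d] suffices: existence of lifts defines [F] on morphisms,
    and their uniqueness makes it functorial. *)
Lemma has_left_adjoint_universal (C D : category) (G : functor C D)
    (F : D -> C) (eta : forall d, hom d (G (F d)))
    (lift : forall d c, hom d (G c) -> hom (F d) c) :
  (forall d c (f : hom d (G c)), compm (fmap G (lift d c f)) (eta d) = f) ->
  (forall d c (g h : hom (F d) c),
     compm (fmap G g) (eta d) = compm (fmap G h) (eta d) -> g = h) ->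
  has_left_adjoint G.
Proof.
move=> liftK etaI.
pose Fmap d d' (h : hom d d') : hom (F d) (F d') := lift d _ (compm (eta d') h).
have FmapE d d' (h : hom d d') :
  compm (fmap G (Fmap d d' h)) (eta d) = compm (eta d') h by exact: liftK.
have Fmap_id d : Fmap d d (idm d) = idm (F d).
  by apply: etaI; rewrite FmapE fmap_id compm_idl compm_idr.
have Fmap_comp d d' d'' (g : hom d' d'') (h : hom d d') :
  Fmap d d'' (compm g h) = compm (Fmap d' d'' g) (Fmap d d' h).
  apply: etaI; rewrite FmapE fmap_comp -compm_assoc FmapE.
  by rewrite !compm_assoc FmapE.
exists (Functor Fmap_id Fmap_comp).
exists (fun d c f => compm (fmap G f) (eta d)); split.
- move=> d c; exists (lift d c) => f; last exact: liftK.
  by apply: etaI; rewrite liftK.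
- by move=> d c c' f g; rewrite fmap_comp compm_assoc.
- by move=> d d' c f h; rewrite fmap_comp -!compm_assoc FmapE.
Qed.

(** * The quotient by inseparability *)

Section Reflection.
Context {I : choiceType}.
Implicit Types (X : ftSigmaMonoid I) (C : hausCMon).

Definition inseparable X (x : X) : set X :=
  [set y | forall C (f : sigmaHom X (G_obj I C)), f x = f y].

(* The operations on this type need two distinct indices in [I], so it carries
   the infiniteness of [I] as a parameter for instance resolution. *)
Definition reflection (_ : infinite_set [set: I]) X : Type :=
  {A : set X | exists x, A = inseparable x}.

Context (I_infinite : infinite_set [set: I]).
Local Notation refl := (reflection I_infinite).

HB.instance Definition _ X := gen_eqMixin (refl X).
HB.instance Definition _ X := gen_choiceMixin (refl X).

Definition refl_pi X (x : X) : refl X :=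
  exist _ (inseparable x) (ex_intro _ x erefl).

Definition refl_repr X (q : refl X) : X := sval (cid (svalP q)).

Definition refl_lift X C (f : sigmaHom X (G_obj I C)) (q : refl X) : C :=
  f (refl_repr q).

Lemma refl_liftE X C (f : sigmaHom X (G_obj I C)) (x : X) :
  refl_lift f (refl_pi x) = f x.
Proof.
rewrite /refl_lift /refl_repr; case: cid => y /= xy; symmetry.
have : inseparable y y by [].
by rewrite -xy; apply.
Qed.

Lemma reflection_eq X (p q : refl X) : sval p = sval q -> p = q.
Proof.
case: p q => [A hA] [B hB] /= AB; subst B.
by congr exist; exact: Prop_irrelevance.
Qed.

Lemma refl_piK X : cancel (@refl_repr X) (@refl_pi X).
Proof.
move=> q; apply: reflection_eq; rewrite /refl_repr /=.
by case: cid => x /= ->.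
Qed.

(** Joint separation of points reduces the monoid laws and the Hausdorff property to those of the
    targets. *)
Lemma refl_lift_inj X (p q : refl X) :
  (forall C (f : sigmaHom X (G_obj I C)), refl_lift f p = refl_lift f q) ->
  p = q.
Proof.
move=> pq; rewrite -[p]refl_piK -[q]refl_piK; apply: reflection_eq => /=.
by apply/seteqP; split=> y py C f; rewrite -(py C f); [symmetry|]; exact: pq.
Qed.

(** * The monoid structure *)

Local Open Scope ring_scope.

(** The sum of the empty family works: Sigma-homomorphisms preserve it, and in [G_obj I C] it is
    0. *)
Lemma exists_sigma_zero X :
  exists z : X, forall C (f : sigmaHom X (G_obj I C)), f z = 0.
Proof.
have [z [zE _]] := sigma_neutral (sm_weak X); exists z => C f.
have := sigmaHomP f zE.
rewrite /= (@extended_sum_finite _ _ _ [::]) ?big_nil; first by case.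
  by [].
by move=> i; case: (set_mem (valP i)).
Qed.

Lemma exists_sigma_add X (x y : X) :
  exists z : X, forall C (f : sigmaHom X (G_obj I C)), f z = f x + f y.
Proof.
(* Two distinct indices give a family with both entries [x] and [y], even when [x = y]. *)
have [i _] := infinite_setN0 I_infinite.
have [j [_ /= ji]] := infinite_setN0 (infinite_setD I_infinite (finite_set1 i)).
have finA : finite_set [set i; j] by exact: finite_set2.
pose w := @Family I X [set i; j] (finite_set_countable finA)
    (fun k => if val k == i then x else y).
have [z zE] := @sm_finitely_total _ X w finA.
exists z => C f; have := sigmaHomP f zE.
pose i' : fam_index w := exist _ i (mem_set (or_introl erefl)).
pose j' : fam_index w := exist _ j (mem_set (or_intror erefl)).
have ij : (val j' == i) = false by apply/eqP.
rewrite /= (@extended_sum_finite _ _ (fam_map f w) [:: i'; j']).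
- by rewrite !big_cons big_nil addr0 /= eqxx ij => -[].
- by rewrite /= inE andbT -val_eqE eq_sym ij.
- move=> k; rewrite !inE -!val_eqE /=.
  by have /set_mem [->|->] := valP k; rewrite eqxx ?orbT.
Qed.

Definition refl_zero X : refl X := refl_pi (sval (cid (exists_sigma_zero X))).

(** The choices are harmless: every lift sends the result to the sum of the lifts, which determines
    it by [refl_lift_inj]. *)
Definition refl_add X (p q : refl X) : refl X :=
  refl_pi (sval (cid (exists_sigma_add (refl_repr p) (refl_repr q)))).

Lemma refl_lift0 X C (f : sigmaHom X (G_obj I C)) :
  refl_lift f (refl_zero X) = 0.
Proof.
by rewrite refl_liftE; exact: (svalP (cid (exists_sigma_zero X)) C f).
Qed.

Lemma refl_liftD X C (f : sigmaHom X (G_obj I C)) p q :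
  refl_lift f (refl_add p q) = refl_lift f p + refl_lift f q.
Proof.
rewrite refl_liftE.
exact: (svalP (cid (exists_sigma_add (refl_repr p) (refl_repr q))) C f).
Qed.

Lemma refl_addA X : associative (@refl_add X).
Proof.
by move=> p q r; apply: refl_lift_inj => C f; rewrite !refl_liftD addrA.
Qed.

Lemma refl_addC X : commutative (@refl_add X).
Proof. by move=> p q; apply: refl_lift_inj => C f; rewrite !refl_liftD addrC. Qed.

Lemma refl_add0 X : left_id (refl_zero X) (@refl_add X).
Proof.
by move=> p; apply: refl_lift_inj => C f; rewrite refl_liftD refl_lift0 add0r.
Qed.

HB.instance Definition _ X :=
  GRing.isNmodule.Build (refl X) (@refl_addA X) (@refl_addC X) (@refl_add0 X).

(** * The initial topology of the lifts *)

Definition refl_subbase X : set (set (refl X)) :=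
  [set A | exists C (f : sigmaHom X (G_obj I C)) U,
     open U /\ A = refl_lift f @^-1` U].

HB.instance Definition _ X :=
  isSubBaseTopological.Build (refl X) (@refl_subbase X) id.

Lemma refl_lift_continuous X C (f : sigmaHom X (G_obj I C)) :
  continuous (refl_lift f).
Proof.
apply/continuousP => U oU.
exists [set refl_lift f @^-1` U]; last by rewrite bigcup_set1.
by move=> _ ->; apply: (@finI_from1 _ _ _ id); exists C, f, U.
Qed.

(** Every neighbourhood of [q] contains a finite intersection of subbasic preimages around [q], and
    filters are closed under finite intersections. *)
Lemma cvg_refl X (F : set_system (refl X)) (q : refl X) : Filter F ->
  (forall C (f : sigmaHom X (G_obj I C)), refl_lift f @ F --> refl_lift f q) ->
  F --> q.
Proof.
move=> FF Fq A; rewrite /= nbhsE => -[B [[D DS <-] [S DSE Sq]]] BA.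
have [E ES SE] := DS _ DSE.
apply: filterS (_ : F S) => [r Sr|]; first by apply: BA; exists S.
rewrite -SE; apply: filter_bigI => V VE.
have /set_mem[C [f [U [oU VU]]]] := ES _ VE.
have Uq : U (refl_lift f q).
  by move: Sq; rewrite /= -SE => /(_ _ VE); rewrite VU.
by rewrite VU; apply: (Fq C f); exact: open_nbhs_nbhs.
Qed.

Lemma refl_add_continuous X :
  continuous (fun pq : refl X * refl X => pq.1 + pq.2).
Proof.
move=> [p q]; apply: cvg_refl => C f.
have lD (r s : refl X) : refl_lift f (r + s) = refl_lift f r + refl_lift f s.
  exact: refl_liftD.
rewrite /= lD.
(* By additivity, a lift composed with addition is the sum in [C] of two continuous maps. *)
have lDE : refl_lift f \o (fun pq : refl X * refl X => pq.1 + pq.2) =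
    (fun pq => refl_lift f pq.1 + refl_lift f pq.2).
  by apply/funext => pq; exact: lD.
rewrite -[X in X --> _]/((refl_lift f \o _) @ (p, q)) lDE.
apply: continuous2_cvg; first exact: (@add_continuous C (_, _)).
  by apply: cvg_comp; [exact: cvg_fst|exact: refl_lift_continuous].
by apply: cvg_comp; [exact: cvg_snd|exact: refl_lift_continuous].
Qed.

HB.instance Definition _ X :=
  PreTopologicalNmodule_isTopologicalNmodule.Build (refl X)
    (@refl_add_continuous X).

(** If all neighbourhoods of [p] and [q] meet, so do those of their images under each lift, which
    therefore coincide in the Hausdorff target. *)
Lemma refl_hausdorff X : hausdorff_space (refl X).
Proof.
move=> p q pq; apply: refl_lift_inj => C f.
apply: (@hcm_hausdorff C) => A B /refl_lift_continuous pA /refl_lift_continuous qB.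
by have [r [Ar Br]] := pq _ _ pA qB; exists (refl_lift f r).
Qed.

Definition refl_ob X : hausCMon := HausCMonOb (@refl_hausdorff X).

(** * The unit and the universal property *)

Lemma refl_pi_sigma X (x : family I X) (v : X) :
  sm_sum x = Some v ->
  extended_sum (fam_map (@refl_pi X) x : family I (refl_ob X)) =
    Some (refl_pi v).
Proof.
move=> xv; apply/(@extended_sumP _ (refl_ob X))/is_sumP.
apply: cvg_refl.
  exact/fmap_filter/summability.totally_filter.
move=> C f; rewrite refl_liftE.
(* A lift turns the partial sums of the classes into those of [fam_map f x], which converge to [f v]
   because [f] is a Sigma-homomorphism. *)
have lE : refl_lift f \o (fun A : {fset fam_index x} =>
    \sum_(i <- A) (refl_pi (x i) : refl_ob X)) =
    (fun A : {fset fam_index x} => \sum_(i <- A) f (x i)).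
  apply/funext => A; rewrite /= (big_morph _ (refl_liftD f) (refl_lift0 f)).
  by apply: eq_bigr => i _; rewrite refl_liftE.
rewrite -[X in X --> _]/((refl_lift f \o _) @ summability.totally) lE.
exact/(@is_sumP _ C (fam_map f x))/extended_sumP/(sigmaHomP f xv).
Qed.

Definition refl_unit X : sigmaHom X (G_obj I (refl_ob X)) :=
  @SigmaHom I X (G_obj I (refl_ob X)) (@refl_pi X) (@refl_pi_sigma X).

Definition refl_lift_hom X C (f : sigmaHom X (G_obj I C)) :
    hausCMonHom (refl_ob X) C :=
  @HausCMonHom (refl_ob X) C (refl_lift f)
    (conj (refl_lift0 f) (refl_liftD f)) (@refl_lift_continuous X C f).

End Reflection.

Theorem theorem8 (I : choiceType) (I_infinite : infinite_set [set: I]%classic) :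
  has_left_adjoint (G I).
Proof.
apply: (@has_left_adjoint_universal HausCMon (SigmaFt I) (G I)
  (refl_ob I_infinite) (refl_unit I_infinite) (refl_lift_hom I_infinite)).
- by move=> X C f; apply: sigmaHom_eq => x; exact: refl_liftE.
(* Surjectivity of [refl_pi] makes a morphism determined by its composite with the unit. *)
- move=> X C g h gh; apply: hausCMonHom_eq => q; rewrite -[q]refl_piK.
  exact: (congr1 (fun k : sigmaHom X (G_obj I C) => k (refl_repr q)) gh).
Qed.
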